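(* There is an absolute constant $c_0>0$ such that the following holds for every $c\ge c_0$. Let $F:\mathbb{R}^d\to\mathbb{R}^{n\times d}$, $b\in\mathbb{R}^n$, $\alpha>0$, and suppose that there are constants $c_1,c_2,c_3,\gamma>0$ such that, for all $x,y\in\mathbb{R}^d$, (i) $\|F(x)\|_2\leq c_1$, (ii) there is $z_x\in\mathbb{R}^d$ such that $\|z_x\|_{\ell_1}\leq c_2\|b\|$ and $F(x)z_x=b$, (iii) $\|F(x)-F(y)\|_2 \leq c_3 \|x-y\|$, (iv) if $y$ is $\frac{4}{\alpha^2}(c_1+c_2+c_1^2c_2)^2\|b\|^2$-sparse, then $(1-\gamma)\|y\|^2 \leq \|F(x)y\|^2\leq (1+\gamma) \|y\|^2$, (v) $\gamma<1-(1+2c_1c_2)c_3\|b\|$. Let $x_\alpha$ be the fixed point satisfying $x_\alpha = \arg\min_{y\in\mathbb{R}^d} \|F(x_\alpha)y-b\|^2+\alpha\|y\|_{\ell_1}$, and let $x_\alpha$ be $k$-sparse. Define $\hat{z}_\alpha := (I-F(x_\alpha)^*F(x_\alpha))x_\alpha + F(x_\alpha)^*b$ and $$K=\frac{4\|x_\alpha\|^2}{\alpha^2} + \frac{4c}{\alpha}C,\qquad C=\sup_{1\leq l<d}\big(\sqrt{l+1}\,\|\hat{z}_\alpha-(\hat{z}_\alpha)_{\{l\}}\|\big).$$ Assume that there is $0<\tilde{\gamma}<\gamma$ such that (a) for all $(K+k)$-sparse vectors $y\in\mathbb{R}^d$, $(1-\tilde{\gamma})\|y\|^2\leq\|F(x_\alpha)y\|^2\leq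 (1+\tilde{\gamma})\|y\|^2$, (b) $\tilde{\gamma}+(1+4c_1c_2)c_3\|b\|<\gamma$. Suppose moreover that there is a $K$-sparse $\hat{x}\in\mathbb{R}^d$ with $F(\hat{x})\hat{x}=b$ such that (a) also holds with $x_\alpha$ replaced by $\hat{x}$, i.e. $(1-\tilde{\gamma})\|y\|^2\leq\|F(\hat{x})y\|^2\leq (1+\tilde{\gamma})\|y\|^2$ for all $(K+k)$-sparse $y\in\mathbb{R}^d$, and that $\frac{c_2c_3}{\sqrt{1-\tilde{\gamma}}}\|b\|<1$. Then $$\|x_\alpha - \hat{x}\| \leq \frac{\sqrt{\alpha c_2\|b\|}}{\sqrt{1-\tilde{\gamma}}-c_2 c_3\|b\|}.$$
   Context: $\|\cdot\|$ is the Euclidean norm, $\|\cdot\|_2$ the spectral norm of matrices, $\|\cdot\|_{\ell_1}$ the $\ell_1$-norm, $M^*$ the transpose of $M$. For a real number $s\ge 0$, a vector is $s$-sparse if it has at most $s$ nonzero entries. $z_{\{l\}}$ is the best $l$-sparse approximation of $z$: it keeps the $l$ largest entries of $z$ in absolute value and is zero elsewhere. The map $\mathscr{S}_\alpha(x):=\arg\min_{y\in\mathbb{R}^d}\|F(x)y-b\|^2+\alpha\|y\|_{\ell_1}$ is taken to be well defined; $x_\alpha$ is the fixed point of $\mathscr{S}_\alpha$, obtained as the limit of the iteration $x\mapsto\mathscr{S}_\alpha(x)$, which converges from any initial vector under (i)–(v). *)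

(* Defs.v *)
From mathcomp Require Import all_boot all_order all_algebra.
From mathcomp Require Import classical_sets reals.
Set Implicit Arguments.
Unset Strict Implicit.
Unset Printing Implicit Defensive.
Import Order.TTheory GRing.Theory Num.Theory.
Local Open Scope classical_set_scope.
Local Open Scope ring_scope.

(* The norm [`|x|] that MathComp-Analysis puts on matrices is the sup norm, so
   the Euclidean, l1 and spectral norms are defined here. *)
Definition norm2 (R : realType) (d : nat) (x : 'cV[R]_d) : R :=
  Num.sqrt (\sum_(i < d) x i 0 ^+ 2).

Definition norm1 (R : realType) (d : nat) (x : 'cV[R]_d) : R :=
  \sum_(i < d) `|x i 0|.

Definition spectral_norm (R : realType) (n d : nat) (A : 'M[R]_(n, d)) : R :=
  sup [set norm2 (A *m v) | v in [set v : 'cV[R]_d | norm2 v <= 1]].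

(* The sparsity level [s] is a real number, not necessarily an integer. *)
Definition sparse (R : realType) (d : nat) (s : R) (x : 'cV[R]_d) : Prop :=
  #|[set i : 'I_d | x i 0 != 0]%SET|%:R <= s.

(* Ties go to the smaller index; the norm of [z - best_sparse l z] does not
   depend on this choice. *)
Definition precedes (R : realType) (d : nat) (z : 'cV[R]_d) (j i : 'I_d) :=
  (`|z i 0| < `|z j 0|) || ((`|z j 0| == `|z i 0|) && (j < i)%N).

Definition best_sparse (R : realType) (d l : nat) (z : 'cV[R]_d) : 'cV[R]_d :=
  \col_i (if (#|[set j | precedes z j i]%SET| < l)%N then z i 0 else 0).

Definition restricted_isometry (R : realType) (n d : nat) (s delta : R)
    (A : 'M[R]_(n, d)) : Prop :=
  forall y : 'cV[R]_d, sparse s y ->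
    (1 - delta) * norm2 y ^+ 2 <= norm2 (A *m y) ^+ 2 <=
    (1 + delta) * norm2 y ^+ 2.

Definition minimizers (R : realType) (d : nat) (f : 'cV[R]_d -> R)
    : set 'cV[R]_d :=
  [set y | forall z, f y <= f z].

Definition objective (R : realType) (n d : nat)
    (F : 'cV[R]_d -> 'M[R]_(n, d)) (b : 'cV[R]_n) (alpha : R)
    (x y : 'cV[R]_d) : R :=
  norm2 (F x *m y - b) ^+ 2 + alpha * norm1 y.

Definition S_well_defined (R : realType) (n d : nat)
    (F : 'cV[R]_d -> 'M[R]_(n, d)) (b : 'cV[R]_n) (alpha : R) : Prop :=
  forall x, exists! y, minimizers (objective F b alpha x) y.

(* The value is [0] when there is no minimizer; this is only meant to be used
   under [S_well_defined]. *)
Definition S_alpha (R : realType) (n d : nat)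
    (F : 'cV[R]_d -> 'M[R]_(n, d)) (b : 'cV[R]_n) (alpha : R)
    (x : 'cV[R]_d) : 'cV[R]_d :=
  xget 0 (minimizers (objective F b alpha x)).

Definition zhat (R : realType) (n d : nat)
    (F : 'cV[R]_d -> 'M[R]_(n, d)) (b : 'cV[R]_n) (x : 'cV[R]_d) : 'cV[R]_d :=
  (1%:M - (F x)^T *m F x) *m x + (F x)^T *m b.

(* For [d <= 1] the supremum is over the empty set and equals [0]. *)
Definition Cconst (R : realType) (d : nat) (z : 'cV[R]_d) : R :=
  sup [set Num.sqrt l.+1%:R * norm2 (z - best_sparse l z)
      | l in [set l : nat | (1 <= l < d)%N]].

Definition Kconst (R : realType) (n d : nat)
    (F : 'cV[R]_d -> 'M[R]_(n, d)) (b : 'cV[R]_n) (alpha c : R)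
    (x : 'cV[R]_d) : R :=
  4 * norm2 x ^+ 2 / alpha ^+ 2 + 4 * c / alpha * Cconst (zhat F b x).

(* Main.v *)
Require Import Defs.
From mathcomp Require Import all_boot all_order all_algebra.
From mathcomp Require Import classical_sets reals.
From mathcomp Require Import ring lra.
Import Order.TTheory GRing.Theory Num.Theory.
Local Open Scope ring_scope.

(** The argument compares the fixed point [xa] with [xhat] through the matrix
    [F xhat], for which [xhat] solves the linear system exactly.

    Since [xa] minimizes the objective attached to [F xa], its value is at most
    that of the exact solution [z] of [F xa *m z = b] with small l1 norm, where
    only the penalty remains: the value at [xa] is at most [alpha * c2 * |b|].
    Each of the two nonnegative terms obeys this bound, so the residual
    [F xa *m xa - b] is at most [sqrt (alpha * c2 * |b|)], and the l1 norm of
    [xa], a fortiori its Euclidean norm, is at most [c2 * |b|]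
    ([fixed_point_bounds]).

    The difference [xa - xhat] is [(K + k)]-sparse, so the isometry property of
    [F xhat] bounds [sqrt (1 - tgamma) * |xa - xhat|] by the norm of
    [F xhat *m (xa - xhat) = (F xhat - F xa) *m xa + (F xa *m xa - b)].
    The Lipschitz condition makes the first summand at most
    [c3 * |xa - xhat| * c2 * |b|], which is absorbed in the left-hand side because
    [sqrt (1 - tgamma) - c2 * c3 * |b|] is positive.

    [K] enters as the sparsity level of [xhat], and the estimate works at every
    level, which is why the threshold on [c] can be taken to be [1]. *)

(** * Norms on column vectors *)

Lemma sqr_norm2 {R : realType} {d : nat} (x : 'cV[R]_d) :
  norm2 x ^+ 2 = \sum_(i < d) x i 0 ^+ 2.
Proof. by rewrite sqr_sqrtr // sumr_ge0 // => i _; apply: sqr_ge0. Qed.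

Lemma norm2_ge0 {R : realType} {d : nat} (x : 'cV[R]_d) : 0 <= norm2 x.
Proof. exact: sqrtr_ge0. Qed.

Lemma norm1_ge0 {R : realType} {d : nat} (x : 'cV[R]_d) : 0 <= norm1 x.
Proof. exact: sumr_ge0. Qed.

Lemma norm2_0 {R : realType} {d : nat} : norm2 (0 : 'cV[R]_d) = 0.
Proof.
by rewrite /norm2 big1 ?sqrtr0 // => i _; rewrite mxE expr0n.
Qed.

Lemma norm2_eq0 {R : realType} {d : nat} {x : 'cV[R]_d} :
  norm2 x = 0 -> x = 0.
Proof.
move=> x0; have := sqr_norm2 x; rewrite x0 expr0n => /esym/psumr_eq0P s0.
apply/colP => i; rewrite mxE; apply/eqP; rewrite -sqrf_eq0; apply/eqP.
by apply: s0 => // j _; apply: sqr_ge0.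
Qed.

Lemma norm2Z {R : realType} {d : nat} (a : R) (x : 'cV[R]_d) :
  norm2 (a *: x) = `|a| * norm2 x.
Proof.
rewrite -sqrtr_sqr -sqrtrM ?sqr_ge0 // mulr_sumr; congr Num.sqrt.
by apply: eq_bigr => i _; rewrite mxE exprMn.
Qed.

Lemma norm2_subC {R : realType} {d : nat} (x y : 'cV[R]_d) :
  norm2 (x - y) = norm2 (y - x).
Proof. by rewrite -opprB -scaleN1r norm2Z normrN1 mul1r. Qed.

(** Cauchy-Schwarz: for nonzero [x] and [y] it expresses that the squared norm of
    [|y| x - |x| y] is nonnegative. *)
Lemma dot_le_norm2 {R : realType} {d : nat} (x y : 'cV[R]_d) :
  \sum_(i < d) x i 0 * y i 0 <= norm2 x * norm2 y.
Proof.
have [/norm2_eq0 ->|x_neq0] := eqVneq (norm2 x) 0.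
  by rewrite norm2_0 mul0r big1 // => i _; rewrite mxE mul0r.
have [/norm2_eq0 ->|y_neq0] := eqVneq (norm2 y) 0.
  by rewrite norm2_0 mulr0 big1 // => i _; rewrite mxE mulr0.
set p := norm2 x; set q := norm2 y.
have p_gt0 : 0 < p by rewrite lt_def x_neq0 norm2_ge0.
have q_gt0 : 0 < q by rewrite lt_def y_neq0 norm2_ge0.
have : 0 <= \sum_(i < d) (q * x i 0 - p * y i 0) ^+ 2.
  by apply: sumr_ge0 => i _; apply: sqr_ge0.
have -> : \sum_(i < d) (q * x i 0 - p * y i 0) ^+ 2 =
    2 * (p * q) * (p * q - \sum_(i < d) x i 0 * y i 0).
  rewrite (eq_bigr (fun i => q ^+ 2 * x i 0 ^+ 2 + p ^+ 2 * y i 0 ^+ 2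
                             - 2 * (p * q) * (x i 0 * y i 0))); last first.
    by move=> i _; ring.
  by rewrite sumrB big_split /= -!mulr_sumr -!sqr_norm2 -/p -/q; ring.
by rewrite pmulr_rge0 ?subr_ge0 // !mulr_gt0.
Qed.

Lemma norm2D {R : realType} {d : nat} (x y : 'cV[R]_d) :
  norm2 (x + y) <= norm2 x + norm2 y.
Proof.
rewrite -ler_sqr ?nnegrE ?addr_ge0 ?norm2_ge0 //.
rewrite sqr_norm2 sqrrD !sqr_norm2.
rewrite (eq_bigr (fun i => x i 0 ^+ 2 + y i 0 ^+ 2 + 2 * (x i 0 * y i 0)));
  last by move=> i _; rewrite mxE; ring.
rewrite !big_split /= -mulr_sumr.
have := dot_le_norm2 x y; lra.
Qed.

Lemma norm2_le_norm1 {R : realType} {d : nat} (x : 'cV[R]_d) :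
  norm2 x <= norm1 x.
Proof.
rewrite -ler_sqr ?nnegrE ?norm2_ge0 ?norm1_ge0 // sqr_norm2 expr2 mulr_suml.
apply: ler_sum => i _; rewrite -real_normK ?num_real // expr2.
by rewrite ler_wpM2l // /norm1 (bigD1 i) //= lerDl sumr_ge0.
Qed.

Lemma entry_le_norm2 {R : realType} {d : nat} (x : 'cV[R]_d) (i : 'I_d) :
  `|x i 0| <= norm2 x.
Proof.
rewrite -ler_sqr ?nnegrE ?norm2_ge0 // real_normK ?num_real // sqr_norm2.
by rewrite (bigD1 i) //= lerDl sumr_ge0 // => j _; apply: sqr_ge0.
Qed.

(** * The spectral norm as an operator norm *)

(** The entrywise l1 norm is a crude bound on the operator norm; it shows that the
    supremum defining the spectral norm is taken over a bounded set. *)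
Lemma norm2_mulmx_entrywise {R : realType} {n d : nat} (A : 'M[R]_(n, d))
    (v : 'cV[R]_d) :
  norm2 (A *m v) <= (\sum_i \sum_j `|A i j|) * norm2 v.
Proof.
apply: le_trans (norm2_le_norm1 _) _; rewrite mulr_suml.
apply: ler_sum => i _; rewrite mxE mulr_suml.
apply: le_trans (ler_norm_sum _ _ _) _; apply: ler_sum => j _.
by rewrite normrM ler_wpM2l // entry_le_norm2.
Qed.

Lemma norm2_mulmx_le {R : realType} {n d : nat} (A : 'M[R]_(n, d))
    (v : 'cV[R]_d) :
  norm2 (A *m v) <= spectral_norm A * norm2 v.
Proof.
have [/norm2_eq0 ->|v_neq0] := eqVneq (norm2 v) 0.
  by rewrite mulmx0 !norm2_0 mulr0.
have v_gt0 : 0 < norm2 v by rewrite lt_def v_neq0 norm2_ge0.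
rewrite -ler_pdivrMr // mulrC -{1}[_^-1]ger0_norm ?invr_ge0 ?norm2_ge0 //.
rewrite -norm2Z scalemxAr; apply: ub_le_sup.
  exists (\sum_i \sum_j `|A i j|) => _ [w w_le1 <-].
  apply: le_trans (norm2_mulmx_entrywise _ _) _.
  by rewrite ler_piMr // !sumr_ge0 // => i _; rewrite sumr_ge0.
exists ((norm2 v)^-1 *: v) => //=.
by rewrite norm2Z ger0_norm ?invr_ge0 ?norm2_ge0 // mulVf.
Qed.

(** * Sparse vectors and fixed points *)

Lemma sparseB {R : realType} {d : nat} {s t : R} {x y : 'cV[R]_d} :
  sparse s x -> sparse t y -> sparse (t + s) (x - y).
Proof.
rewrite /sparse [t + s]addrC => xs yt; apply: le_trans (lerD xs yt).
rewrite -natrD ler_nat -cardsUI; apply: leq_trans (leq_addr _ _).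
apply/subset_leq_card/fintype.subsetP => i; rewrite !inE !mxE.
apply: contraR; rewrite negb_or !negbK => /andP[/eqP -> /eqP ->].
by rewrite subr0.
Qed.

Lemma S_alpha_min {R : realType} {n d : nat}
    {F : 'cV[R]_d -> 'M[R]_(n, d)} {b : 'cV[R]_n} {alpha : R}
    (x y : 'cV[R]_d) :
  S_well_defined F b alpha ->
  objective F b alpha x (S_alpha F b alpha x) <= objective F b alpha x y.
Proof.
move=> /(_ x) [m [m_min _]].
by have /(_ y) := xgetPex 0 (ex_intro _ m m_min : exists y, minimizers _ y).
Qed.

(** An exact solution [z] of the linear system at the fixed point has no residual,
    so its objective value is the mere penalty [alpha * norm1 z]. *)
Lemma fixed_point_bounds {R : realType} {n d : nat}
    {F : 'cV[R]_d -> 'M[R]_(n, d)} {b : 'cV[R]_n} {alpha m : R}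
    {x z : 'cV[R]_d} :
  0 < alpha -> S_well_defined F b alpha -> x = S_alpha F b alpha x ->
  F x *m z = b -> norm1 z <= m ->
  norm2 (F x *m x - b) <= Num.sqrt (alpha * m) /\ norm1 x <= m.
Proof.
move=> alpha_gt0 S_wd x_fix Fz z_le.
have := S_alpha_min x z S_wd.
rewrite -x_fix /objective Fz subrr norm2_0 expr0n add0r => obj_le.
have pen_le : alpha * norm1 z <= alpha * m by rewrite ler_pM2l.
have x_ge0 : 0 <= alpha * norm1 x by rewrite mulr_ge0 ?norm1_ge0 // ltW.
have r_ge0 := sqr_ge0 (norm2 (F x *m x - b)).
split; last by rewrite -(ler_pM2l alpha_gt0); lra.
rewrite -[leLHS]ger0_norm ?norm2_ge0 // -sqrtr_sqr ler_wsqrtr //; lra.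
Qed.

(** * The error estimate *)

Lemma restricted_isometry_lower {R : realType} {n d : nat} {s delta : R}
    {A : 'M[R]_(n, d)} {y : 'cV[R]_d} :
  delta <= 1 -> restricted_isometry s delta A -> sparse s y ->
  Num.sqrt (1 - delta) * norm2 y <= norm2 (A *m y).
Proof.
move=> delta_le1 rip /rip /andP[lower _].
rewrite -ler_sqr ?nnegrE ?mulr_ge0 ?sqrtr_ge0 ?norm2_ge0 //.
by rewrite exprMn sqr_sqrtr // subr_ge0.
Qed.

Theorem proposition4p9 (R : realType) :
  exists c0 : R, 0 < c0 /\
  forall c : R, c0 <= c ->
  forall (n d : nat) (F : 'cV[R]_d -> 'M[R]_(n, d)) (b : 'cV[R]_n)
    (alpha c1 c2 c3 gamma : R),
  0 < alpha -> 0 < c1 -> 0 < c2 -> 0 < c3 -> 0 < gamma ->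
  (* (i) *)
  (forall x, spectral_norm (F x) <= c1) ->
  (* (ii) *)
  (forall x, exists z : 'cV[R]_d,
     norm1 z <= c2 * norm2 b /\ F x *m z = b) ->
  (* (iii) *)
  (forall x y, spectral_norm (F x - F y) <= c3 * norm2 (x - y)) ->
  (* (iv) *)
  (forall x, restricted_isometry
     (4 / alpha ^+ 2 * (c1 + c2 + c1 ^+ 2 * c2) ^+ 2 * norm2 b ^+ 2)
     gamma (F x)) ->
  (* (v) *)
  gamma < 1 - (1 + 2 * c1 * c2) * c3 * norm2 b ->
  S_well_defined F b alpha ->
  forall (xa : 'cV[R]_d) (k : R),
  xa = S_alpha F b alpha xa ->
  sparse k xa ->
  let K := Kconst F b alpha c xa in
  forall tgamma : R,
  0 < tgamma -> tgamma < gamma ->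
  (* (a) *)
  restricted_isometry (K + k) tgamma (F xa) ->
  (* (b) *)
  tgamma + (1 + 4 * c1 * c2) * c3 * norm2 b < gamma ->
  forall xhat : 'cV[R]_d,
  sparse K xhat ->
  F xhat *m xhat = b ->
  restricted_isometry (K + k) tgamma (F xhat) ->
  c2 * c3 / Num.sqrt (1 - tgamma) * norm2 b < 1 ->
  norm2 (xa - xhat) <=
    Num.sqrt (alpha * c2 * norm2 b)
    / (Num.sqrt (1 - tgamma) - c2 * c3 * norm2 b).
Proof.
exists 1; split=> // c _ n d F b alpha c1 c2 c3 gamma alpha_gt0 c1_gt0 c2_gt0
  c3_gt0 _ _ solvable F_lip _ gamma_lt S_wd xa k xa_fix xa_sparse K tgamma _
  tgamma_lt _ _ xhat xhat_sparse Fxhat xhat_rip contraction.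
set r := Num.sqrt (1 - tgamma).
have b_ge0 := norm2_ge0 b.
have slack_ge0 : 0 <= (1 + 2 * c1 * c2) * c3 * norm2 b.
  by rewrite !mulr_ge0 ?addr_ge0 ?mulr_ge0 // ltW.
(* The upper bound on gamma forces gamma < 1, so the square root is not the
   default value 0. *)
have tgamma_lt1 : tgamma < 1 by lra.
have r_gt0 : 0 < r by rewrite sqrtr_gt0 subr_gt0.
have denom_gt0 : 0 < r - c2 * c3 * norm2 b.
  by rewrite subr_gt0 -[ltRHS]mul1r -ltr_pdivrMr // mulrAC.
have [z [z_le Fz]] := solvable xa.
have [res_le xa_le] := fixed_point_bounds alpha_gt0 S_wd xa_fix Fz z_le.
rewrite ler_pdivlMr // mulrC mulrBl lerBlDr.
have diff_sparse := sparseB xa_sparse xhat_sparse.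
apply: le_trans
  (restricted_isometry_lower (ltW tgamma_lt1) xhat_rip diff_sparse) _.
(* The exactness of xhat turns F xhat *m xhat into b, and the residual of xa is
   taken at F xa, where minimality controls it. *)
have -> : F xhat *m (xa - xhat)
    = (F xa *m xa - b) + (F xhat - F xa) *m xa.
  by rewrite mulmxBr mulmxBl Fxhat [RHS]addrC addrA subrK.
apply: le_trans (norm2D _ _) _; apply: lerD; first by rewrite -mulrA.
apply: le_trans (norm2_mulmx_le _ _) _.
have xa2_le := le_trans (norm2_le_norm1 xa) xa_le.
apply: (@le_trans _ _ (c3 * norm2 (xa - xhat) * (c2 * norm2 b))); last by lra.
have lip : spectral_norm (F xhat - F xa) <= c3 * norm2 (xa - xhat).
  by rewrite norm2_subC.
apply: le_trans (ler_wpM2r (norm2_ge0 _) lip) _.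
by rewrite ler_wpM2l // mulr_ge0 ?norm2_ge0 // ltW.
Qed.
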